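(* For every prime power $q>4$ there exist infinitely many (pairwise non-isomorphic) $(q+1,q)$-regular left-sided Ramanujan hypergraphs.
   Context: A hypergraph $H=(V,E)$ has a finite vertex set and a finite family of subsets of $V$ (edges); $\nu(H)=|V|$, $e(H)=|E|$. It is $(d,r)$-regular if every edge has $r$ vertices and every vertex lies in exactly $d$ edges. The adjacency matrix $A(H)$ has $(u,v)$-entry the number of edges containing both $u,v$ for $u\ne v$ and $0$ on the diagonal; its eigenvalues (with multiplicity) are $\lambda_1(H)\ge\cdots\ge\lambda_{\nu(H)}(H)$. If $d<r$, $A(H)$ has the obvious eigenvalue $-d$ with multiplicity at least $\nu(H)-e(H)$. A connected $(d,r)$-regular hypergraph is left-sided Ramanujan if every non-obvious eigenvalue $\lambda$ (i.e. the eigenvalues remaining after removing $\max\{\nu(H)-e(H),0\}$ copies of $-d$) satisfies $\lambda\ge r-2-2\sqrt{(d-1)(r-1)}$; equivalently $\lambda_{\tau_H}(H)\ge r-2-2\sqrt{(d-1)(r-1)}$ where $\tau_H=\min\{\nu(H),e(H)\}$. *)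

(* Defs.v *)
From HB Require Import structures.
From mathcomp Require Import all_boot all_order all_algebra.
From mathcomp Require Import reals.
Set Implicit Arguments.
Unset Strict Implicit.
Unset Printing Implicit Defensive.
Import Order.TTheory GRing.Theory Num.Theory.
Local Open Scope ring_scope.

(* Edges form a set of subsets: no repeated edges. *)
Record hypergraph := Hypergraph {
  vertex : finType;
  edges : {set {set vertex}} }.

Definition nu (H : hypergraph) : nat := #|vertex H|.
Definition ne (H : hypergraph) : nat := #|edges H|.

Definition hregular (d r : nat) (H : hypergraph) : Prop :=
  (forall e : {set vertex H}, e \in edges H -> #|e| = r) /\
  (forall v : vertex H, #|[set e in edges H | v \in e]| = d).

Definition hadj (H : hypergraph) : rel (vertex H) :=
  fun u v => [exists e in edges H, (u \in e) && (v \in e)].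

Definition hconnected (H : hypergraph) : Prop :=
  (0 < nu H)%N /\ forall u v : vertex H, connect (@hadj H) u v.

Definition hiso (H1 H2 : hypergraph) : Prop :=
  exists f : vertex H1 -> vertex H2,
    bijective f /\ [set f @: e | e : {set vertex H1} in edges H1] = edges H2.

(* Rows and columns are indexed by the vertices through [enum_val]. *)
Definition adjacency (R : realType) (H : hypergraph) : 'M[R]_(nu H) :=
  \matrix_(i, j)
    if i == j then 0
    else #|[set e in edges H | (enum_val i \in e) && (enum_val j \in e)]|%:R.

(* [s] lists all eigenvalues of [A], with algebraic multiplicity, in
   nonincreasing order; such an [s] is unique, and it exists whenever [A] is
   symmetric. *)
Definition eigenvalues (R : realType) (n : nat) (A : 'M[R]_n) (s : seq R) :
    Prop :=
  sorted (fun x y => y <= x) s /\ char_poly A = \prod_(x <- s) ('X - x%:P).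

(* Removes max (nu H - ne H, 0) copies of the obvious eigenvalue -d; the
   subtraction on nat is truncated. *)
Definition nonobvious (R : realType) (d : nat) (H : hypergraph) (s : seq R) :
    seq R :=
  iter (nu H - ne H)%N (rem (- d%:R)) s.

Definition left_sided_ramanujan (R : realType) (d r : nat) (H : hypergraph) :
    Prop :=
  [/\ hconnected H, hregular d r H &
    exists2 s : seq R, eigenvalues (adjacency R H) s &
      forall x : R, x \in nonobvious d H s ->
        r%:R - 2 - 2 * Num.sqrt ((d%:R - 1) * (r%:R - 1)) <= x].

Definition prime_power (q : nat) : Prop :=
  exists p k : nat, [/\ prime p, (0 < k)%N & q = (p ^ k)%N].

(* Main.v *)
(* The affine plane of order q is (q+1,q)-regular, and its point-line incidence
   matrix B satisfies B B^T = q I + J, so |B^T x| >= sqrt q |x|. Take n+1 copies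
   of the plane and join them into a connected cyclic cover by letting one fixed
   line of each copy take one fixed point from the next copy. This adds to B a
   matrix of operator norm at most 2, so the cover satisfies
   |B^T x| >= (sqrt q - 2) |x|. Since B B^T = A + (q+1) I, the Ramanujan bound
   only asks for |B^T x| >= (sqrt q - sqrt (q-1)) |x|, and sqrt (q-1) >= 2 holds
   as soon as q > 4. *)
From mathcomp Require Import all_boot all_order all_algebra.
From mathcomp Require Import finfield complex reals zify ring lra.
Require Import Defs.

Set Implicit Arguments.
Unset Strict Implicit.
Unset Printing Implicit Defensive.
Import Order.TTheory GRing.Theory Num.Theory.
Local Open Scope ring_scope.

(** * Spectra of real symmetric matrices *)

Lemma eigenvalue_symmetric_real (C : numClosedFieldType) n (A : 'M[C]_n) z :
  A^T = A -> map_mx Num.conj A = A -> eigenvalue A z -> z \is Num.real.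
Proof.
move=> symA realA /eigenvalueP[v vA v_neq0]; apply/CrealP.
(* [D] is the Hermitian square norm of [v]. Letting [A] act on either side of [v *m A *m w^T] gives
   [z] and its conjugate as the same multiple of [D]. *)
pose w := map_mx Num.conj v.
have wA : w *m A = z^* *: w by rewrite -{1}realA -map_mxM vA map_mxZ.
pose D := v *m w^T; have D_neq0 : D 0 0 != 0.
  rewrite !mxE; apply: contraNneq v_neq0 => D0; apply/eqP/rowP => k.
  rewrite [RHS]mxE; apply/eqP; rewrite -normr_eq0 -sqrf_eq0 normCK; apply/eqP.
  have := psumr_eq0P _ D0 (i := k); rewrite !mxE; apply=> // i _.
  by rewrite !mxE mul_conjC_ge0.
have : z *: D = z^* *: D.
  rewrite scalemxAl -vA -mulmxA -{1}symA -trmx_mul wA linearZ /=.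
  by rewrite -scalemxAr.
by move=> /matrixP/(_ 0 0); rewrite [LHS]mxE [RHS]mxE => /(mulIf D_neq0).
Qed.

(** Over the algebraically closed extension the polynomial splits and its roots, being eigenvalues,
    are real; the factorisation then descends along the injective embedding. *)
Lemma char_poly_symmetric_split (R : rcfType) n (A : 'M[R]_n) :
  A^T = A -> exists s : seq R, char_poly A = \prod_(x <- s) ('X - x%:P).
Proof.
move=> symA; pose f := real_complex R; pose B := map_mx f A.
have symB : B^T = B by rewrite map_trmx symA.
have realB : map_mx Num.conj B = B.
  apply/matrixP => i j; rewrite !mxE; apply: conj_Creal.
  by apply/complex_realP; exists (A i j).
have [r] := closed_field_poly_normal (char_poly B).
rewrite (monicP (char_poly_monic B)) scale1r => Br.
have rK : map f (map (@complex.Re R) r) = r.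
  rewrite -map_comp map_id_in // => z zr /=; apply: RRe_real.
  apply: (eigenvalue_symmetric_real symB realB).
  by rewrite eigenvalue_root_char Br root_prod_XsubC.
exists (map (@complex.Re R) r); apply: (map_poly_inj f).
rewrite map_char_poly -/B Br -{1}rK !big_map rmorph_prod /=.
by apply: eq_bigr => z _; rewrite rmorphB /= map_polyX map_polyC.
Qed.

(** * The Ramanujan bound as a bound on a quadratic form *)

Lemma sum_edges_sqr (R : realType) (d r : nat) (H : hypergraph)
    (v : 'rV[R]_(nu H)) : hregular d r H ->
  \sum_(e in edges H) (\sum_(u in e) v 0 (enum_rank u)) ^+ 2 =
  (v *m adjacency R H *m v^T) 0 0 + d%:R * (v *m v^T) 0 0.
Proof.
move=> [_ degH].
(* [c] is the Gram matrix B B^T of the incidence matrix B: it agrees with the adjacency matrix off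
   the diagonal and has the degree [d] on it. *)
pose c (i j : 'I_(nu H)) : R :=
  #|[set e in edges H | (enum_val i \in e) && (enum_val j \in e)]|%:R.
transitivity (\sum_(i < nu H) \sum_(j < nu H) v 0 i * v 0 j * c i j).
  transitivity (\sum_(e in edges H) \sum_(i < nu H) \sum_(j < nu H)
    v 0 i * v 0 j * ((enum_val i \in e) && (enum_val j \in e))%:R).
    apply: eq_bigr => e _.
    have -> : \sum_(u in e) v 0 (enum_rank u) =
              \sum_(i < nu H) (enum_val i \in e)%:R * v 0 i.
      rewrite big_mkcond /= (reindex (fun i : 'I_(nu H) => enum_val i)) /=;
        last exact/onW_bij/enum_val_bij.
      by apply: eq_bigr => i _; rewrite enum_valK; case: ifP;
        rewrite ?mul1r ?mul0r.
    rewrite expr2 mulr_suml; apply: eq_bigr => i _.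
    rewrite mulr_sumr; apply: eq_bigr => j _.
    by rewrite mulrACA [RHS]mulrC -natrM mulnb.
  rewrite exchange_big; apply: eq_bigr => i _ /=.
  rewrite exchange_big; apply: eq_bigr => j _ /=.
  rewrite -mulr_sumr -natr_sum -big_mkcondr /= sum1_card /c.
  by congr (_ * _%:R); apply: eq_card => e; rewrite !inE.
rewrite -mulmxA !mxE mulr_sumr -big_split; apply: eq_bigr => i _ /=.
rewrite !mxE (bigD1 i) //= [X in _ = _ * X + _](bigD1 i) //= !mxE eqxx.
have -> : c i i = d%:R.
  by rewrite -(degH (enum_val i)) /c; under eq_finset do rewrite andbb.
rewrite mul0r add0r addrC; congr (_ + _); last by rewrite mulrC.
rewrite mulr_sumr.
apply: eq_bigr => j ji; rewrite !mxE eq_sym (negPf ji) -/(c i j).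
by rewrite -mulrA [c i j * _]mulrC.
Qed.

Lemma adjacency_sym (R : realType) (H : hypergraph) :
  (adjacency R H)^T = adjacency R H.
Proof.
apply/matrixP => i j; rewrite !mxE eq_sym; case: eqP => // _.
by congr _%:R; apply: eq_card => e; rewrite !inE [X in _ && X]andbC.
Qed.

Lemma mem_nonobvious (R : realType) d H (s : seq R) :
  {subset nonobvious d H s <= s}.
Proof.
rewrite /nonobvious; elim: (_ - _)%N => //= k IHk x /mem_rem; exact: IHk.
Qed.

(** On an eigenvector for the eigenvalue [x], the sum over edges is [x + d] times the squared norm;
    this is why the constant is the Ramanujan bound shifted by [d]. The resulting bound covers the
    whole spectrum, hence its nonobvious part. *)
Lemma left_sided_ramanujan_of_sum_edges_sqr (R : realType) d r H :
    hconnected H -> hregular d r H ->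
    (forall x : vertex H -> R,
      (d%:R + r%:R - 2 - 2 * Num.sqrt ((d%:R - 1) * (r%:R - 1)))
        * \sum_u x u ^+ 2 <= \sum_(e in edges H) (\sum_(u in e) x u) ^+ 2) ->
  left_sided_ramanujan R d r H.
Proof.
move=> conH regH lowH; split => //.
have [s chiE] := char_poly_symmetric_split (adjacency_sym R H).
exists (sort (fun x y => y <= x) s).
  split; first by apply: sort_sorted => x y; exact: le_total.
  by rewrite chiE; apply/esym/perm_big; rewrite perm_sort.
move=> x /mem_nonobvious; rewrite mem_sort -root_prod_XsubC -chiE.
rewrite -eigenvalue_root_char => /eigenvalueP[v vA v_neq0].
have := lowH (fun u => v 0 (enum_rank u)).
rewrite (sum_edges_sqr _ regH) vA -scalemxAl.
have -> : \sum_u v 0 (enum_rank u) ^+ 2 = (v *m v^T) 0 0.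
  rewrite mxE (reindex (fun i : 'I_(nu H) => enum_val i)) /=;
    last exact/onW_bij/enum_val_bij.
  by apply: eq_bigr => i _; rewrite enum_valK mxE.
rewrite [X in _ <= X + _ -> _]mxE -mulrDl ler_pM2r; first by lra.
rewrite mxE lt_def; apply/andP; split.
  apply: contraNneq v_neq0 => v0; apply/eqP/rowP => k.
  rewrite [RHS]mxE; apply/eqP; rewrite -sqrf_eq0 expr2; apply/eqP.
  have := psumr_eq0P _ v0 (i := k); rewrite !mxE; apply=> // i _.
  by rewrite !mxE -expr2 sqr_ge0.
by apply: sumr_ge0 => i _; rewrite !mxE -expr2 sqr_ge0.
Qed.

Lemma hadj_sym (H : hypergraph) : symmetric (@hadj H).
Proof. by move=> x y; apply: eq_existsb => e; rewrite [X in _ && X]andbC. Qed.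

(** * Affine planes and their incidence form *)

Record affine_plane (q : nat) := AffinePlane {
  point : finType;
  line : finType;
  pts : line -> {set point};
  card_pts : forall l, #|pts l| = q;
  card_pencil : forall u, #|[set l | u \in pts l]| = q.+1;
  card_joins : forall u v, u != v ->
    #|[set l | (u \in pts l) && (v \in pts l)]| = 1%N }.

Section AffinePlaneTheory.
Variables (q : nat) (S : affine_plane q).
Implicit Types (u v : point S) (l k : line S).

Lemma line_through u v :
  u != v -> exists l, (u \in pts l) && (v \in pts l).
Proof.
move=> /card_joins/eqP/cards1P[l lE]; exists l.
by have := set11 l; rewrite -lE inE.
Qed.

Lemma line_unique u v l k : u != v ->
  u \in pts l -> v \in pts l -> u \in pts k -> v \in pts k -> l = k.
Proof.
move=> /card_joins/eqP/cards1P[l' l'E] ul vl uk vk.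
have /set1P -> : l \in [set l'] by rewrite -l'E inE ul.
by have /set1P -> : k \in [set l'] by rewrite -l'E inE uk.
Qed.

(** This is B B^T = q I + J. Two distinct points share one line and a single point lies on q + 1;
    one unit of every count goes into the square of the total. *)
Lemma sum_lines_sqr (R : comNzRingType) (x : point S -> R) :
  \sum_l (\sum_(u in pts l) x u) ^+ 2 =
  q%:R * \sum_u x u ^+ 2 + (\sum_u x u) ^+ 2.
Proof.
transitivity (\sum_u \sum_v x u * x v
    * #|[set l : line S | (u \in pts l) && (v \in pts l)]|%:R).
  transitivity (\sum_(l : line S) \sum_u \sum_v
      x u * x v * ((u \in pts l) && (v \in pts l))%:R).
    apply: eq_bigr => l _; rewrite big_mkcond /= expr2 mulr_suml.
    apply: eq_bigr => u _; rewrite mulr_sumr; apply: eq_bigr => v _.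
    by do 2![case: (_ \in _)]; rewrite ?mulr1 ?mulr0 ?mul0r.
  rewrite exchange_big; apply: eq_bigr => u _ /=.
  rewrite exchange_big; apply: eq_bigr => v _ /=.
  rewrite -mulr_sumr -natr_sum -big_mkcond sum1_card.
  by congr (_ * _%:R); apply: eq_card => l; rewrite !inE.
rewrite expr2 mulr_suml mulr_sumr -big_split; apply: eq_bigr => u _ /=.
rewrite mulr_sumr (bigD1 u) //= [in RHS](bigD1 u) //= addrA.
congr (_ + _).
  have -> : [set l | (u \in pts l) && (u \in pts l)] = [set l | u \in pts l].
    by apply/setP => l; rewrite !inE andbb.
  by rewrite card_pencil -natr1; ring.
by apply: eq_bigr => v vu; rewrite card_joins 1?eq_sym // mulr1.
Qed.

End AffinePlaneTheory.

(** * The connected cyclic cover of an affine plane *)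

Section CyclicCover.
Variables (q n : nat) (S : affine_plane q) (p0 : point S) (l0 : line S).
Hypotheses (p0l0 : p0 \in pts l0) (q_gt2 : (2 < q)%N).
Implicit Types (i j : 'I_n.+1) (u v : point S) (l k : line S).

(* Line [l0] of copy [j] takes its point [p0] from the next copy; every other
   incidence stays within its copy. *)
Definition sheet l u j := if (l == l0) && (u == p0) then ordS j else j.

Definition cover_edge (jl : 'I_n.+1 * line S) : {set 'I_n.+1 * point S} :=
  [set (sheet jl.2 u jl.1, u) | u in pts jl.2].

Definition cover : hypergraph := Hypergraph [set cover_edge jl | jl : _].

Lemma sheet_bij l u : bijective (sheet l u).
Proof.
rewrite /sheet; case: (_ && _); first exact: ordS_bij.
by exists id.
Qed.

Lemma mem_cover_edge i u j l :
  ((i, u) \in cover_edge (j, l)) = (u \in pts l) && (i == sheet l u j).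
Proof.
apply/imsetP/andP => [[v vl [-> ->]] // | [ul /eqP ->]].
by exists u.
Qed.

Lemma mem_cover_edge_neq i u j l : u != p0 ->
  ((i, u) \in cover_edge (j, l)) = (u \in pts l) && (i == j).
Proof. by move=> up; rewrite mem_cover_edge /sheet (negPf up) andbF. Qed.

(** Incidences at points other than [p0] stay in their copy. Since q > 2, each line has two such
    points: they reveal the copy and determine the line. *)
Lemma cover_edge_inj : injective cover_edge.
Proof.
move=> [j l] [k m] E.
have : (1 < #|pts l :\ p0|)%N.
  have := cardsD1 p0 (pts l); rewrite card_pts; case: (_ \in _); lia.
move=> /card_gt1P[u [v [/setD1P[up ul] /setD1P[vp vl] uv]]].
have := mem_cover_edge_neq j j l up; rewrite E mem_cover_edge_neq // ul eqxx.
move=> /andP[um /eqP jk].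
have := mem_cover_edge_neq j j l vp; rewrite E mem_cover_edge_neq // vl eqxx.
move=> /andP[vm _].
by rewrite -jk (line_unique uv ul vl um vm).
Qed.

(** For fixed [l] and [u], [sheet l u] permutes the copies, so each line through [u] has exactly one
    lift through [(i, u)]. The degree is thus that of the plane. *)
Lemma cover_regular : hregular q.+1 q cover.
Proof.
split=> [e /imsetP[[j l] _ ->] | [i u]].
  by rewrite card_imset ?card_pts // => v w [].
pose A := [set jl | (i, u) \in cover_edge jl].
have -> : [set e in edges cover | (i, u) \in e] = cover_edge @: A.
  apply/setP => e; rewrite inE; apply/andP/imsetP.
    by move=> [/imsetP[jl _ ->] iu]; exists jl; rewrite // inE.
  move=> [jl]; rewrite inE => iu ->; split => //; exact: imset_f.
rewrite card_imset; last exact: cover_edge_inj.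
rewrite -(card_pencil u).
have [g sg] : exists g : line S -> 'I_n.+1, forall l, sheet l u (g l) = i.
  apply: (@fin_all_exists _ _ (fun l j => sheet l u j = i)) => l.
  by have [h _ hK] := sheet_bij l u; exists (h i).
have -> : A = [set (g l, l) | l in [set l | u \in pts l]].
  apply/setP => -[j l]; rewrite inE mem_cover_edge; apply/andP/imsetP.
    move=> [ul /eqP iE]; exists l; rewrite ?inE //.
    by congr (_, _); apply: (bij_inj (sheet_bij l u)); rewrite sg.
  by move=> [k]; rewrite inE => uk [-> ->]; rewrite sg.
by rewrite card_imset // => l k [].
Qed.

Lemma cover_hadj (a b : vertex cover) jl :
  a \in cover_edge jl -> b \in cover_edge jl -> hadj a b.
Proof.
move=> a_jl b_jl; apply/existsP; exists (cover_edge jl).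
by rewrite a_jl b_jl imset_f.
Qed.

(** Each copy has a hub [u0]: a point other than [p0] shares a line with it, and [p0] reaches it
    along a line [k] that is not rerouted. The edge of [l0] from copy [i] contains [u1] in that copy
    and [p0] in the next, which links consecutive copies. *)
Lemma cover_connected : hconnected cover.
Proof.
split; first by apply/card_gt0P; exists (ord0, p0).
have csym := sym_connect_sym (@hadj_sym cover).
have [u1 u1l u1p] : exists2 u, u \in pts l0 & u != p0.
  have : (0 < #|pts l0 :\ p0|)%N.
    have := cardsD1 p0 (pts l0); rewrite card_pts; case: (_ \in _); lia.
  by move=> /card_gt0P[u /setD1P[up ul]]; exists u.
have [k p0k kl0] : exists2 k, p0 \in pts k & k != l0.
  have : (0 < #|[set k | p0 \in pts k] :\ l0|)%N.
    have := cardsD1 l0 [set k | p0 \in pts k]; rewrite card_pencil.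
    case: (_ \in _); lia.
  by move=> /card_gt0P[k /setD1P[kl]]; rewrite inE; exists k.
have [u0 u0k u0p] : exists2 u, u \in pts k & u != p0.
  have : (0 < #|pts k :\ p0|)%N.
    have := cardsD1 p0 (pts k); rewrite card_pts; case: (_ \in _); lia.
  by move=> /card_gt0P[u /setD1P[up ul]]; exists u.
have in_sheet i u : connect (@hadj cover) (i, u) (i, u0).
  have [-> | up] := eqVneq u p0.
    apply/connect1/(@cover_hadj _ _ (i, k)).
      by rewrite mem_cover_edge p0k /sheet (negPf kl0) /=.
    by rewrite mem_cover_edge_neq // u0k /=.
  have [-> // | uu0] := eqVneq u u0.
  have [l /andP[ul u0l]] := line_through uu0.
  apply/connect1/(@cover_hadj _ _ (i, l)).
    by rewrite mem_cover_edge_neq // ul /=.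
  by rewrite mem_cover_edge_neq // u0l /=.
have next i : connect (@hadj cover) (i, u0) (ordS i, u0).
  apply: (@connect_trans _ _ (i, u1)); first by rewrite csym.
  apply: (@connect_trans _ _ (ordS i, p0)) => //.
  apply/connect1/(@cover_hadj _ _ (i, l0)).
    by rewrite mem_cover_edge_neq // u1l /=.
  by rewrite mem_cover_edge p0l0 /sheet !eqxx /=.
have from0 i : connect (@hadj cover) (ord0, u0) (i, u0).
  case: i => m; elim: m => [|m IHm] ltmn.
    by rewrite (_ : Ordinal ltmn = ord0) //; apply: val_inj.
  apply: connect_trans (IHm (ltnW ltmn)) _.
  rewrite (_ : Ordinal ltmn = ordS (Ordinal (ltnW ltmn))) //.
  by apply: val_inj; rewrite /= modn_small.
move=> [i u] [j v].
apply: connect_trans (in_sheet i u) _.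
rewrite csym; apply: connect_trans (in_sheet j v) _.
by rewrite csym; apply: connect_trans (from0 j); rewrite csym.
Qed.

Lemma sum_cover_edges_sqr_ge (R : realType) (x : vertex cover -> R) :
    (4 < q)%N ->
  (Num.sqrt q%:R - 2) ^+ 2 * \sum_a x a ^+ 2 <=
  \sum_(e in edges cover) (\sum_(a in e) x a) ^+ 2.
Proof.
move=> q_gt4; set s := Num.sqrt q%:R.
have sqrs : s ^+ 2 = q%:R by rewrite sqr_sqrtr.
have s_ge0 : 0 <= s by rewrite sqrtr_ge0.
have s_gt2 : 2 < s.
  have : (4%:R : R) < q%:R by rewrite ltr_nat.
  by move=> ?; nra.
(* [a] is the line sum in the disjoint copies, and [b] is the correction due to rerouting [p0]. *)
pose a j l := \sum_(u in pts l) x (j, u).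
pose b j l := if l == l0 then x (ordS j, p0) - x (j, p0) else 0.
have -> : \sum_(e in edges cover) (\sum_(a in e) x a) ^+ 2 =
          \sum_j \sum_l (a j l + b j l) ^+ 2.
  rewrite big_imset /=; last by move=> ? ? _ _; exact: cover_edge_inj.
  rewrite pair_big /=; apply: eq_big => [jl | [j l] _]; first by rewrite inE.
  rewrite big_imset /=; last by move=> ? ? _ _ [].
  congr (_ ^+ 2); rewrite /a /b /sheet; case: eqP => [-> | _] /=; last first.
    by rewrite addr0.
  rewrite (bigD1 p0) //= [in RHS](bigD1 p0) //= eqxx.
  rewrite (eq_bigr (fun u => x (j, u))) => [|u /andP[_ /negPf -> //]].
  by ring.
pose X := \sum_a x a ^+ 2.
have sumX : X = \sum_j \sum_u x (j, u) ^+ 2.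
  by rewrite pair_big; apply: eq_bigr => -[].
have suma : q%:R * X <= \sum_j \sum_l a j l ^+ 2.
  rewrite sumX mulr_sumr; apply: ler_sum => j _.
  by rewrite sum_lines_sqr lerDl sqr_ge0.
(* The constant 4 comes from (y - z)^2 <= 2 y^2 + 2 z^2 together with the fact that [ordS] permutes
   the copies, so that each value at [p0] occurs twice. *)
have sumb : \sum_j \sum_l b j l ^+ 2 <= 4 * X.
  pose y j := x (j, p0) ^+ 2.
  apply: (@le_trans _ _ (\sum_j (2 * y (ordS j) + 2 * y j))).
    apply: ler_sum => j _; rewrite (bigD1 l0) //= big1 => [|l /negPf ll0].
      rewrite /b /y eqxx addr0.
      by have := sqr_ge0 (x (ordS j, p0) + x (j, p0)); lra.
    by rewrite /b ll0 expr0n.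
  rewrite big_split -!mulr_sumr /=.
  have -> : \sum_j y (ordS j) = \sum_j y j.
    by rewrite [RHS](reindex (@ordS n.+1)) //; exact/onW_bij/ordS_bij.
  have : \sum_j y j <= X.
    rewrite sumX; apply: ler_sum => j _; rewrite (bigD1 p0) //= lerDl.
    by apply: sumr_ge0 => u _; rewrite sqr_ge0.
  by lra.
(* AM-GM, with the weight optimal for [|a|^2 = q X] and [|b|^2 = 4 X] *)
have ab j l : (1 - 2 / s) * a j l ^+ 2 - (s / 2 - 1) * b j l ^+ 2 <=
              (a j l + b j l) ^+ 2.
  rewrite -subr_ge0.
  have -> : (a j l + b j l) ^+ 2 -
      ((1 - 2 / s) * a j l ^+ 2 - (s / 2 - 1) * b j l ^+ 2) =
      2 / s * (a j l + s / 2 * b j l) ^+ 2.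
    by field; rewrite gt_eqF //; lra.
  by rewrite mulr_ge0 ?sqr_ge0 ?divr_ge0.
apply: (@le_trans _ _ (\sum_j \sum_l
  ((1 - 2 / s) * a j l ^+ 2 - (s / 2 - 1) * b j l ^+ 2))); last first.
  by apply: ler_sum => j _; apply: ler_sum => l _; exact: ab.
under [Y in _ <= Y]eq_bigr do rewrite sumrB -!mulr_sumr.
rewrite sumrB -!mulr_sumr.
(* As s > 2, both weights are nonnegative, so [suma] and [sumb] can be inserted; since q = s^2, the
   result is exactly (s - 2)^2. *)
have t_ge0 : 0 <= 1 - 2 / s.
  by rewrite subr_ge0 ler_pdivrMr ?mul1r; lra.
have -> : (s - 2) ^+ 2 * X = (1 - 2 / s) * (q%:R * X) - (s / 2 - 1) * (4 * X).
  by rewrite -sqrs; field; rewrite gt_eqF //; lra.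
by rewrite lerB // ler_wpM2l //; lra.
Qed.

Lemma cover_ramanujan (R : realType) :
  (4 < q)%N -> left_sided_ramanujan R q.+1 q cover.
Proof.
move=> q_gt4; apply: left_sided_ramanujan_of_sum_edges_sqr.
- exact: cover_connected.
- exact: cover_regular.
move=> x; apply: le_trans (sum_cover_edges_sqr_ge x q_gt4).
rewrite ler_wpM2r //; first by apply: sumr_ge0 => a _; rewrite sqr_ge0.
have q4 : (5%:R : R) <= q%:R by rewrite ler_nat.
rewrite -natr1 addrK sqrtrM ?ler0n //.
(* The shifted Ramanujan constant is (s - w)^2. From q >= 5 follows 2 <= w <= s, hence 0 <= s - w <=
   s - 2. *)
set s := Num.sqrt q%:R; set w := Num.sqrt (q%:R - 1).
have sqrs : s ^+ 2 = q%:R by rewrite sqr_sqrtr.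
have sqrw : w ^+ 2 = q%:R - 1 by rewrite sqr_sqrtr // subr_ge0; lra.
have s_ge0 : 0 <= s by rewrite sqrtr_ge0.
have w_ge0 : 0 <= w by rewrite sqrtr_ge0.
have w_ge2 : 2 <= w by nra.
have ws : w <= s by nra.
have -> : q%:R + 1 + q%:R - 2 - 2 * (s * w) = (s - w) ^+ 2.
  by rewrite sqrrB sqrs sqrw mulr_natl; ring.
by rewrite ler_sqr ?nnegrE; lra.
Qed.

End CyclicCover.

(** * The affine plane over a finite field *)

Section FieldPlane.
Variable F : finFieldType.

(** Slope and intercept, or the abscissa of a vertical line, give every line exactly one code, so
    that counting codes counts lines. *)
Definition field_pts (l : F * F + F) : {set F * F} :=
  match l with
  | inl (m, b) => [set (x, m * x + b) | x : F]
  | inr c => [set (c, y) | y : F]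
  end.

Lemma mem_field_ptsl m b x y :
  ((x, y) \in field_pts (inl (m, b))) = (y == m * x + b).
Proof.
by apply/imsetP/eqP => [[z _ [-> ->]] | ->] //; exists x.
Qed.

Lemma mem_field_ptsr c x y : ((x, y) \in field_pts (inr c)) = (x == c).
Proof.
by apply/imsetP/eqP => [[z _ [-> _]] | ->] //; exists y.
Qed.

Lemma card_field_pts l : #|field_pts l| = #|F|.
Proof. by case: l => [[m b] | c]; rewrite card_imset // => x y []. Qed.

Lemma card_field_pencil u : #|[set l | u \in field_pts l]| = #|F|.+1.
Proof.
case: u => x y.
have -> : [set l | (x, y) \in field_pts l] =
          inr x |: [set inl (m, y - m * x) | m : F].
  apply/setP => -[[m b] | c]; rewrite !inE ?mem_field_ptsl ?mem_field_ptsr.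
    apply/eqP/imsetP => [-> | [m' _ [-> ->]]]; last by rewrite addrC subrK.
    by exists m; rewrite // addrC addKr.
  apply/eqP/orP => [-> | [/eqP[] // | /imsetP[]//]]; by left.
rewrite cardsU1 card_imset => [|m m' [] //].
by case: imsetP => // -[].
Qed.

Lemma card_field_joins u v : u != v ->
  #|[set l | (u \in field_pts l) && (v \in field_pts l)]| = 1%N.
Proof.
case: u v => [x y] [x' y'] uv; apply/eqP/cards1P.
have [xx' | xx'] := eqVneq x x'.
  have yy' : y != y' by apply: contraNneq uv => ->; rewrite xx'.
  exists (inr x); apply/setP => -[[m b] | c];
    rewrite !inE ?mem_field_ptsl ?mem_field_ptsr -xx'.
    by apply/negP => /andP[/eqP yE /eqP y'E]; case/eqP: yy'; rewrite yE.
  by rewrite andbb; apply/eqP/eqP => [-> | [->]].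
have dx : x' - x != 0 by rewrite subr_eq0 eq_sym.
pose m0 := (y' - y) / (x' - x).
exists (inl (m0, y - m0 * x)).
apply/setP => -[[m b] | c];
  rewrite !inE ?mem_field_ptsl ?mem_field_ptsr; last first.
  by apply/negP => /andP[/eqP <- /eqP x'E]; case/eqP: xx'.
apply/andP/eqP => [[/eqP yE /eqP y'E] | [-> ->]]; last first.
  by rewrite /m0; split; apply/eqP; field.
have <- : m = m0 by rewrite /m0 y'E yE; field.
by rewrite yE addrC addKr.
Qed.

Definition field_plane : affine_plane #|F| :=
  AffinePlane card_field_pts card_field_pencil card_field_joins.

End FieldPlane.

(** * Infinitely many covers, told apart by their vertex counts *)

Lemma hiso_nu (H1 H2 : hypergraph) : hiso H1 H2 -> nu H1 = nu H2.
Proof. by move=> [f [/bij_eq_card]]. Qed.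

Theorem theorem1p9 (R : realType) (q : nat) (hq : prime_power q)
    (hq4 : (4 < q)%N) :
  exists H : nat -> hypergraph,
    (forall n : nat, left_sided_ramanujan R q.+1 q (H n)) /\
    (forall m n : nat, m <> n -> ~ hiso (H m) (H n)).
Proof.
have [p [k [p_pr k_gt0 qE]]] := hq.
have [F _ cardF] := pPrimePowerField p_pr k_gt0.
move: hq4; rewrite qE -cardF => {hq qE} hq4.
pose p0 : point (field_plane F) := (0, 0).
pose l0 : line (field_plane F) := inr 0.
have p0l0 : p0 \in pts l0 by rewrite mem_field_ptsr.
(* The cover of index [n] consists of n + 1 copies and has (n + 1) q^2 vertices, which determines
   [n]. *)
exists (fun n => cover n p0 l0); split=> [n | m n mn /hiso_nu].
  exact: cover_ramanujan p0l0 (ltnW (ltnW hq4)) R hq4.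
rewrite /nu /= !card_prod !card_ord => /eqP.
by rewrite eqn_pmul2r ?muln_gt0 ?(leq_trans _ hq4) // => /eqP[].
Qed.
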